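(* Let $q$ be a complex number with $0<|q|<1$, let $r$ be a nonnegative integer, and let $a$ and $b_1,\dots,b_{2r+1}$ be complex numbers with $\max\left\{\left|\frac{a^rq^r}{b_1b_2\cdots b_{2r+1}}\right|,\left|\frac{q^r}{b_1b_2\cdots b_{2r+1}}\right|\right\}<1$ (where $a$ is the variable of the limit below). Then $$\lim_{a\to1}\;{}_{2r+4}W_{2r+3}\!\left(a;b_1,\dots,b_{2r+1};q,\frac{a^rq^r}{b_1\cdots b_{2r+1}}\right)={}_{2r+1}\psi_{2r+1}\!\left[\begin{matrix}b_1,\dots,b_{2r+1}\\ q/b_1,\dots,q/b_{2r+1}\end{matrix};q,\frac{q^r}{b_1\cdots b_{2r+1}}\right].$$
   Context: Notation. $(x;q)_\infty=\prod_{i=0}^\infty(1-xq^i)$ and, for every integer $n$, $(x;q)_n=(x;q)_\infty/(xq^n;q)_\infty$, i.e. $(x;q)_n=\prod_{i=0}^{n-1}(1-xq^i)$ for $n\ge0$ and $(x;q)_{-n}=\prod_{i=1}^{n}(1-xq^{-i})^{-1}$ for $n\geq 1$. For several parameters, $(x_1,\dots,x_s;q)_m=(x_1;q)_m\cdots(x_s;q)_m$. Very-well-poised series: for $n$ parameters $\beta_1,\dots,\beta_n$, $${}_{n+3}W_{n+2}(\alpha;\beta_1,\dots,\beta_n;q,z)=\sum_{k=0}^\infty\frac{(\alpha,q\sqrt\alpha,-q\sqrt\alpha,\beta_1,\dots,\beta_n;q)_k}{(q,\sqrt\alpha,-\sqrt\alpha,\alpha q/\beta_1,\dots,\alpha q/\beta_n;q)_k}z^k,\qquad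 \frac{(q\sqrt\alpha,-q\sqrt\alpha;q)_k}{(\sqrt\alpha,-\sqrt\alpha;q)_k}=\frac{1-\alpha q^{2k}}{1-\alpha}.$$ Bilateral series: ${}_s\psi_s\!\left[\begin{matrix}a_1,\dots,a_s\\ c_1,\dots,c_s\end{matrix};q,z\right]=\sum_{k=-\infty}^{\infty}\frac{(a_1,\dots,a_s;q)_k}{(c_1,\dots,c_s;q)_k}z^k.$ Standing convention: the parameters are such that every expression occurring is well defined (no denominator vanishes, including the denominator factors of the terms of the series). *)

(* Defs.v *)
From Stdlib Require Import Reals ZArith List Lra Psatz.
From Coquelicot Require Import Coquelicot.
Import ListNotations.
Open Scope C_scope.

Definition Cprod (l : list C) : C := fold_right Cmult (RtoC 1) l.

Definition Czpow (z : C) (k : Z) : C :=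
  match k with
  | Zneg p => / z ^ Pos.to_nat p
  | _ => z ^ Z.to_nat k
  end.

(** [(x;q)_n] for every integer [n], as the finite products to which
    [(x;q)_oo / (x q^n;q)_oo] reduces. *)
Definition qpoch (x q : C) (n : Z) : C :=
  match n with
  | Zneg p => Cprod (map (fun i => / (1 - x / q ^ i)) (seq 1 (Pos.to_nat p)))
  | _ => Cprod (map (fun i => 1 - x * q ^ i) (seq 0 (Z.to_nat n)))
  end.

Definition qpochs (xs : list C) (q : C) (n : Z) : C :=
  Cprod (map (fun x => qpoch x q n) xs).

(** The principal branch. *)
Definition Csqrt (z : C) : C :=
  (sqrt ((Cmod z + Re z) / 2),
   (if Rle_dec 0 (Im z) then 1 else -1) * sqrt ((Cmod z - Re z) / 2))%R.

Lemma Csqrt_sqr (z : C) : Csqrt z * Csqrt z = z.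
Proof.
destruct z as [x y].
assert (Hm : (Cmod (x, y) * Cmod (x, y) = x * x + y * y)%R).
{ unfold Cmod; simpl fst; simpl snd. rewrite sqrt_sqrt; nra. }
assert (H0 := Cmod_ge_0 (x, y)).
unfold Csqrt, Cmult; simpl Re; simpl Im; simpl fst; simpl snd.
set (m := Cmod (x, y)) in *.
assert (Hx : (Rabs x <= m)%R).
{ unfold m. exact (Rle_trans _ _ _ (Rmax_l _ _) (Rmax_Cmod (x, y))). }
assert (Hp : (0 <= (m + x) / 2)%R) by (apply Rabs_le_between in Hx; lra).
assert (Hn : (0 <= (m - x) / 2)%R) by (apply Rabs_le_between in Hx; lra).
assert (Hpn : (sqrt ((m + x) / 2) * sqrt ((m - x) / 2) = Rabs y / 2)%R).
{ rewrite <- sqrt_mult by assumption.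
  replace ((m + x) / 2 * ((m - x) / 2))%R with (Rsqr (y / 2))
    by (unfold Rsqr; nra).
  rewrite sqrt_Rsqr_abs. unfold Rdiv. rewrite Rabs_mult.
  rewrite (Rabs_right (/ 2)); lra. }
assert (Sp := sqrt_sqrt _ Hp). assert (Sn := sqrt_sqrt _ Hn).
set (u := sqrt ((m + x) / 2)) in *. set (v := sqrt ((m - x) / 2)) in *.
destruct (Rle_dec 0 y) as [Hy | Hy].
- rewrite Rabs_right in Hpn by lra. f_equal; nra.
- rewrite Rabs_left in Hpn by lra. f_equal; nra.
Qed.

(** Sum of a complex series; meaningful when the series converges. *)
Definition CSeries (f : nat -> C) : C :=
  iota (T := C_CompleteNormedModule) (is_series f).

Lemma CSeries_unique (f : nat -> C) (l : C) : is_series f l -> CSeries f = l.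
Proof.
intros H.
exact (iota_filterlim_locally (V := C_CompleteNormedModule) (sum_n f) l H).
Qed.

(** Both halves of a bilateral series are required to converge. *)
Definition ex_biseries (f : Z -> C) : Prop :=
  ex_series (fun n : nat => f (Z.of_nat n)) /\
  ex_series (fun n : nat => f (- Z.of_nat (S n))%Z).

Definition CBiseries (f : Z -> C) : C :=
  CSeries (fun n : nat => f (Z.of_nat n)) +
  CSeries (fun n : nat => f (- Z.of_nat (S n))%Z).

(** Very-well-poised series [_{n+3}W_{n+2}(alpha; bs; q, z)], [n = length bs]. *)
Definition W_term (alpha : C) (bs : list C) (q z : C) (k : nat) : C :=
  qpochs ([alpha; q * Csqrt alpha; - (q * Csqrt alpha)] ++ bs) q (Z.of_nat k) /
  qpochs ([q; Csqrt alpha; - Csqrt alpha] ++ map (fun b => alpha * q / b) bs)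
         q (Z.of_nat k) * z ^ k.

Definition W (alpha : C) (bs : list C) (q z : C) : C :=
  CSeries (W_term alpha bs q z).

(** Since [/ 0 = 0] in [C], a factor [1 / (c;q)_(-n)] is the finite product
    of the [1 - c / q ^ i], [1 <= i <= n], also when this product is [0]:
    the usual convention for terminating series. *)
Definition psi_term (num den : list C) (q z : C) (k : Z) : C :=
  qpochs num q k / qpochs den q k * Czpow z k.

Definition psi (num den : list C) (q z : C) : C :=
  CBiseries (psi_term num den q z).

(* Main.v *)
Require Import Defs.
From Stdlib Require Import Reals ZArith List.
From Coquelicot Require Import Coquelicot.
From Stdlib Require Import Lra Lia.
Open Scope C_scope.

(** Consecutive terms of the very-well-poised series satisfy
    [t_(k+1) = t_k G(a, q^k)] with [G] continuous at [(1, 0)] and [G(1, 0) = z],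
    where [z] is the argument of the bilateral series. As [|z| < 1], the terms
    are dominated by one geometric sequence for all [a] near [1], so that the
    limit may be taken termwise. The limit of [t_k] is [(1 + q^k) p_k] for
    [k > 0], and [1] for [k = 0], where [p_k] is the general term of the
    bilateral series. Finally [q^k p_k = p_(-k)]. *)

(** * Limits of complex functions along a filter *)

Lemma Cfilterlim_iff {T : Type} (F : (T -> Prop) -> Prop) {FF : Filter F}
    (f : T -> C) (l : C) :
  filterlim f F (locally l) <->
  forall eps : R, (0 < eps)%R -> F (fun x => (Cmod (f x - l) < eps)%R).
Proof.
split.
- intros H eps He.
  exact (proj1 (filterlim_locally_ball_norm (U := C_NormedModule) f l) H
           (mkposreal eps He)).
- intros H.
  apply (filterlim_locally_ball_norm (U := C_NormedModule)).
  intros eps. exact (H eps (cond_pos eps)).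
Qed.

Section Limits.

Context {T : Type} {F : (T -> Prop) -> Prop} {FF : Filter F}.

Lemma Cfilterlim_plus (f g : T -> C) (l m : C) :
  filterlim f F (locally l) -> filterlim g F (locally m) ->
  filterlim (fun x => f x + g x) F (locally (l + m)).
Proof.
intros Hf Hg.
exact (filterlim_comp_2 _ _ _ Hf Hg (filterlim_plus (V := C_NormedModule) l m)).
Qed.

Lemma Cfilterlim_mult (f g : T -> C) (l m : C) :
  filterlim f F (locally l) -> filterlim g F (locally m) ->
  filterlim (fun x => f x * g x) F (locally (l * m)).
Proof.
intros Hf Hg.
(* [filterlim_mult] uses the neighbourhoods of the absolute-value ring structure on [C]; [locally_C]
   identifies them with those of the product structure. *)
assert (HC : forall (h : T -> C) (y : C),
  filterlim h F (locally y) <->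
  filterlim h F (locally (T := AbsRing_UniformSpace C_AbsRing) y)).
{ intros h y. split; intros H P HP; apply H; now apply locally_C. }
apply HC. apply HC in Hf. apply HC in Hg.
exact (filterlim_comp_2 _ _ _ Hf Hg (filterlim_mult (K := C_AbsRing) l m)).
Qed.

Lemma Cfilterlim_opp (f : T -> C) (l : C) :
  filterlim f F (locally l) -> filterlim (fun x => - f x) F (locally (- l)).
Proof.
intros Hf.
exact (filterlim_comp _ _ _ _ _ _ _ _ Hf (filterlim_opp (V := C_NormedModule) l)).
Qed.

Lemma Cfilterlim_Cmod (f : T -> C) (l : C) :
  filterlim f F (locally l) ->
  filterlim (fun x => Cmod (f x)) F (locally (Cmod l)).
Proof.
intros Hf.
exact (filterlim_comp _ _ _ f Cmod _ _ _ Hf (filterlim_norm (V := C_NormedModule) l)).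
Qed.

Lemma Cfilterlim_inv (f : T -> C) (l : C) :
  l <> 0 -> filterlim f F (locally l) ->
  filterlim (fun x => / f x) F (locally (/ l)).
Proof.
intros Hl Hf. apply Cfilterlim_iff; [exact FF|]. intros eps He.
assert (Hp := proj1 (Cmod_gt_0 l) Hl).
assert (Hf' := proj1 (Cfilterlim_iff F f l) Hf).
(* The first bound keeps [Cmod (f x)] above [Cmod l / 2]; with that, the second makes
   [Cmod (f x - l) / (Cmod (f x) * Cmod l)] smaller than [eps]. *)
assert (Hd : (0 < Rmin (Cmod l / 2) (eps * (Cmod l * Cmod l) / 2))%R).
{ apply Rmin_pos; [lra|]. assert (0 < Cmod l * Cmod l)%R by nra. nra. }
refine (filter_imp _ _ _ (Hf' _ Hd)). intros x Hx.
assert (Hx1 := Rlt_le_trans _ _ _ Hx (Rmin_l _ _)).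
assert (Hx2 := Rlt_le_trans _ _ _ Hx (Rmin_r _ _)).
assert (Ht := Cmod_triangle (f x) (- (f x - l))).
rewrite Cmod_opp in Ht.
replace (f x + - (f x - l)) with l in Ht by ring.
assert (Hfx : f x <> 0).
{ apply Cmod_gt_0. lra. }
replace (/ f x - / l) with (- (f x - l) / (f x * l)) by (field; auto).
rewrite Cmod_div, Cmod_opp, Cmod_mult by (apply Cmult_neq_0; auto).
assert (Hpp : (0 < Cmod (f x) * Cmod l)%R) by nra.
apply Rmult_lt_reg_r with (1 := Hpp).
unfold Rdiv. rewrite Rmult_assoc, Rinv_l by lra.
assert (Hh : (Cmod l / 2 <= Cmod (f x))%R) by lra.
assert (Hm := Rmult_le_compat_l (eps * Cmod l) _ _ ltac:(nra) Hh). nra.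
Qed.
End Limits.

(** * Complex series and termwise limits under a geometric majorant *)

Lemma CSeries_correct (f : nat -> C) : ex_series f -> is_series f (CSeries f).
Proof.
intros [l Hl]. now rewrite (CSeries_unique f l Hl).
Qed.

Lemma CSeries_incr_1 (f : nat -> C) :
  ex_series f -> CSeries f = f 0%nat + CSeries (fun k => f (S k)).
Proof.
intros Hf. assert (Hl := CSeries_correct f Hf).
set (l := CSeries f) in *.
rewrite (CSeries_unique (fun k => f (S k)) (l - f 0%nat)).
- ring.
- apply (is_series_incr_1 (V := C_NormedModule) f (l - f 0%nat)).
  change (is_series f (l - f 0%nat + f 0%nat)).
  replace (l - f 0%nat + f 0%nat) with l by ring. exact Hl.
Qed.

Lemma ex_series_geom_bound (f : nat -> C) (M rho : R) :
  (0 <= rho < 1)%R -> (forall k, (Cmod (f k) <= M * rho ^ k)%R) -> ex_series f.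
Proof.
intros Hrho Hf.
apply (ex_series_le (V := C_CompleteNormedModule) f (fun k => (M * rho ^ k)%R) Hf).
apply (ex_series_scal_l (V := R_NormedModule) M (fun k => rho ^ k)%R).
apply ex_series_geom. rewrite Rabs_pos_eq; lra.
Qed.

Lemma Cmod_CSeries_geom_le (f : nat -> C) (M rho : R) :
  (0 <= rho < 1)%R -> (forall k, (Cmod (f k) <= M * rho ^ k)%R) ->
  (Cmod (CSeries f) <= M / (1 - rho))%R.
Proof.
intros Hrho Hf.
assert (Hs := CSeries_correct f (ex_series_geom_bound f M rho Hrho Hf)).
assert (Hg : is_series (fun k => M * rho ^ k)%R (M / (1 - rho))%R).
{ apply (is_series_scal_l (V := R_NormedModule) M (fun k => rho ^ k)%R (/ (1 - rho))%R).
  apply is_series_geom. rewrite Rabs_pos_eq; lra. }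
refine (is_lim_seq_le (fun n => Cmod (sum_n f n)) _ (Cmod (CSeries f)) (M / (1 - rho))%R _ _ Hg).
- intros n.
  apply Rle_trans with (sum_n (fun k => Cmod (f k)) n).
  + exact (norm_sum_n_m (V := C_NormedModule) f 0 n).
  + apply sum_n_m_le. exact Hf.
- exact (Cfilterlim_Cmod _ _ Hs).
Qed.

(** Tannery's theorem: the first [N] terms converge one by one, and the two remaining tails together
    are at most [2 * (M / (1 - rho)) * rho ^ N], uniformly in [a]. *)
Lemma tannery_geom {T : Type} (F : (T -> Prop) -> Prop) {FF : Filter F}
    (rho : R) (u : nat -> C) (t : T -> nat -> C) (M : R) :
  (0 <= rho < 1)%R ->
  (forall k, (Cmod (u k) <= M * rho ^ k)%R) ->
  F (fun a => forall k, (Cmod (t a k) <= M * rho ^ k)%R) ->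
  (forall k, filterlim (fun a => t a k) F (locally (u k))) ->
  filterlim (fun a => CSeries (t a)) F (locally (CSeries u)).
Proof.
intros Hrho Hu Ht Hl.
(* Induction on [N] by splitting off the first terms. The sequences and [B] are quantified because
   the shift replaces [B] by [B * rho]; each split spends half of the current [eps]. *)
assert (HN : forall (N : nat) (v : nat -> C) (s : T -> nat -> C) (B : R),
  (forall k, (Cmod (v k) <= B * rho ^ k)%R) ->
  F (fun a => forall k, (Cmod (s a k) <= B * rho ^ k)%R) ->
  (forall k, filterlim (fun a => s a k) F (locally (v k))) ->
  forall eps, (0 < eps)%R ->
  F (fun a => (Cmod (CSeries (s a) - CSeries v)
               < eps + 2 * (B / (1 - rho)) * rho ^ N)%R)).
{ clear u t M Hu Ht Hl.
  induction N as [|N IH]; intros v s B Hv Hs Hl eps He.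
  - refine (filter_imp _ _ _ Hs). intros a Ha.
    assert (H1 := Cmod_CSeries_geom_le _ _ _ Hrho Ha).
    assert (H2 := Cmod_CSeries_geom_le _ _ _ Hrho Hv).
    assert (H3 := Cmod_triangle (CSeries (s a)) (- CSeries v)).
    rewrite Cmod_opp in H3. unfold Cminus. simpl. lra.
  - assert (Hv' : forall k, (Cmod (v (S k)) <= B * rho * rho ^ k)%R).
    { intros k. generalize (Hv (S k)). simpl. lra. }
    assert (Hs' : F (fun a => forall k, (Cmod (s a (S k)) <= B * rho * rho ^ k)%R)).
    { refine (filter_imp _ _ _ Hs). intros a Ha k.
      generalize (Ha (S k)). simpl. lra. }
    assert (H1 := IH (fun k => v (S k)) (fun a k => s a (S k)) _ Hv' Hs'
                    (fun k => Hl (S k)) (eps / 2)%R ltac:(lra)).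
    assert (H0 := proj1 (Cfilterlim_iff F _ _) (Hl 0%nat) (eps / 2)%R ltac:(lra)).
    refine (filter_imp _ _ _ (filter_and _ _ Hs (filter_and _ _ H0 H1))).
    intros a (Ha & Ha0 & Ha1).
    rewrite (CSeries_incr_1 (s a)) by exact (ex_series_geom_bound _ _ _ Hrho Ha).
    rewrite (CSeries_incr_1 v) by exact (ex_series_geom_bound _ _ _ Hrho Hv).
    set (x := CSeries (fun k => s a (S k))) in *.
    set (y := CSeries (fun k => v (S k))) in *.
    replace (s a 0%nat + x - (v 0%nat + y))
      with (s a 0%nat - v 0%nat + (x - y)) by ring.
    assert (H3 := Cmod_triangle (s a 0%nat - v 0%nat) (x - y)).
    unfold Rdiv in *. simpl pow. lra. }
apply Cfilterlim_iff; [exact FF|]. intros eps He.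
assert (HM : (0 <= M)%R).
{ generalize (Hu 0%nat) (Cmod_ge_0 (u 0%nat)). simpl. lra. }
set (D := (2 * (M / (1 - rho)))%R).
assert (HD : (0 <= D)%R).
{ unfold D. apply Rmult_le_pos; [lra|]. apply Rdiv_le_0_compat; lra. }
(* This [N] makes [D * rho ^ N] less than [eps / 2]; dividing by [D + 1] covers the case [D = 0]. *)
destruct (pow_lt_1_zero rho ltac:(rewrite Rabs_pos_eq; lra) (eps / 2 / (D + 1))%R)
  as [N HNrho].
{ apply Rdiv_lt_0_compat; lra. }
specialize (HNrho N (le_n N)).
refine (filter_imp (F := F) _ _ _ (HN N u t M Hu Ht Hl (eps / 2)%R ltac:(lra))).
intros a Ha. fold D in Ha.
assert (Hr := pow_le rho N (proj1 Hrho)).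
rewrite Rabs_pos_eq in HNrho by exact Hr.
apply (Rmult_lt_compat_r (D + 1)) in HNrho; [|lra].
unfold Rdiv in HNrho at 1. rewrite Rmult_assoc, Rinv_l in HNrho by lra. nra.
Qed.

(** Each of the finitely many terms before the ratio bound sets in stays near its limit, so one
    constant [M] serves all [a] at once. Induction on [K] removes one such term at a time. *)
Lemma geom_bound_of_ratio {T : Type} (F : (T -> Prop) -> Prop) {FF : Filter F}
    (rho : R) (K : nat) (u : nat -> C) (t : T -> nat -> C) :
  (0 < rho)%R ->
  F (fun a => forall k, (K <= k)%nat -> (Cmod (t a (S k)) <= rho * Cmod (t a k))%R) ->
  (forall k, filterlim (fun a => t a k) F (locally (u k))) ->
  exists M, F (fun a => forall k, (Cmod (t a k) <= M * rho ^ k)%R).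
Proof.
intros Hrho. revert u t. induction K as [|K IH]; intros u t Hr Hl.
- exists (Cmod (u 0%nat) + 1)%R.
  assert (H0 := proj1 (Cfilterlim_iff F _ _) (Hl 0%nat) 1%R ltac:(lra)).
  refine (filter_imp _ _ _ (filter_and _ _ Hr H0)).
  intros a [Ha Ha0] k. induction k as [|k IHk].
  + assert (H := Cmod_triangle (t a 0%nat - u 0%nat) (u 0%nat)).
    replace (t a 0%nat - u 0%nat + u 0%nat) with (t a 0%nat) in H by ring.
    simpl. lra.
  + assert (H := Ha k (Nat.le_0_l k)). simpl. nra.
- destruct (IH (fun k => u (S k)) (fun a k => t a (S k))) as [M HM].
  + refine (filter_imp _ _ _ Hr). intros a Ha k Hk. apply Ha. lia.
  + intros k. apply Hl.
  (* The entry [M / rho] undoes the shift: [M * rho ^ k = (M / rho) * rho ^ S k]. *)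
  + set (B := Rmax (Cmod (u 0%nat) + 1) (M / rho)). exists B.
    assert (H0 := proj1 (Cfilterlim_iff F _ _) (Hl 0%nat) 1%R ltac:(lra)).
    refine (filter_imp _ _ _ (filter_and _ _ HM H0)).
    intros a [Ha Ha0] [|k].
    * assert (H := Cmod_triangle (t a 0%nat - u 0%nat) (u 0%nat)).
      replace (t a 0%nat - u 0%nat + u 0%nat) with (t a 0%nat) in H by ring.
      assert (HB := Rmax_l (Cmod (u 0%nat) + 1) (M / rho)). fold B in HB.
      simpl. lra.
    * apply Rle_trans with (1 := Ha k).
      assert (HB := Rmax_r (Cmod (u 0%nat) + 1) (M / rho)). fold B in HB.
      apply (Rmult_le_compat_r rho) in HB; [|lra].
      unfold Rdiv in HB. rewrite Rmult_assoc, Rinv_l in HB by lra.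
      assert (Hp := pow_lt rho k Hrho). simpl. nra.
Qed.

(** The limit of the ratio is taken jointly in [a] and [k], which yields a threshold [K] and a ratio
    bound [rho] independent of [a], hence a common geometric majorant. *)
Lemma tannery_ratio {T : Type} (F : (T -> Prop) -> Prop) {FF : ProperFilter F}
    (u : nat -> C) (t g : T -> nat -> C) (z : C) :
  (Cmod z < 1)%R ->
  (forall a k, t a (S k) = t a k * g a k) ->
  filterlim (fun p => g (fst p) (snd p)) (filter_prod F eventually) (locally z) ->
  (forall k, filterlim (fun a => t a k) F (locally (u k))) ->
  F (fun a => ex_series (t a)) /\ ex_series u /\
  filterlim (fun a => CSeries (t a)) F (locally (CSeries u)).
Proof.
intros Hz Hg Hgl Hl.
assert (Hz0 := Cmod_ge_0 z).
(* The midpoint of [Cmod z] and 1: ratios within [rho - Cmod z] of [z] have modulus below [rho]. *)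
set (rho := ((Cmod z + 1) / 2)%R).
assert (Hrho : (0 < rho < 1)%R) by (unfold rho; lra).
assert (HK : exists K,
  F (fun a => forall k, (K <= k)%nat -> (Cmod (t a (S k)) <= rho * Cmod (t a k))%R)).
{ assert (H := proj1 (Cfilterlim_iff _ _ _) Hgl (rho - Cmod z)%R
                 ltac:(unfold rho; lra)).
  destruct H as [P Q HP [K HQ] HPQ]. exists K.
  refine (filter_imp _ _ _ HP). intros a Ha k Hk.
  assert (H := HPQ a k Ha (HQ k Hk)). simpl in H.
  assert (H' := Cmod_triangle (g a k - z) z).
  replace (g a k - z + z) with (g a k) in H' by ring.
  rewrite Hg, Cmod_mult. generalize (Cmod_ge_0 (t a k)). nra. }
destruct HK as [K HK].
destruct (geom_bound_of_ratio F rho K u t (proj1 Hrho) HK Hl) as [M HM].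
(* Non-strict bounds pass to the limit since [F] is proper. *)
assert (Hu : forall k, (Cmod (u k) <= M * rho ^ k)%R).
{ intros k.
  refine (filterlim_le (F := F) (fun a => Cmod (t a k)) (fun _ => M * rho ^ k)%R
            (Cmod (u k)) (M * rho ^ k)%R _ _ _).
  - refine (filter_imp _ _ _ HM). intros a Ha. apply Ha.
  - exact (Cfilterlim_Cmod _ _ (Hl k)).
  - exact (filterlim_const (F := F) (U := R_UniformSpace) (M * rho ^ k)%R). }
assert (Hrho' : (0 <= rho < 1)%R) by lra.
split; [|split].
- refine (filter_imp _ _ _ HM). intros a Ha.
  exact (ex_series_geom_bound _ _ _ Hrho' Ha).
- exact (ex_series_geom_bound _ _ _ Hrho' Hu).
- exact (tannery_geom F rho u t M Hrho' Hu HM Hl).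
Qed.

(** * Inverses under the convention [/ 0 = 0], and finite products *)

Lemma Cinv_0 : / (0 : C) = 0.
Proof. unfold Cinv, RtoC. simpl. unfold Rdiv. f_equal; ring. Qed.

Lemma Cminus_diag_uniq (x y : C) : x - y = 0 -> x = y.
Proof.
intros H. replace x with (x - y + y) by ring. rewrite H. ring.
Qed.

(** If a factor is 0, both sides are 0. This lets the quotients of products below be split without
    nonvanishing conditions. *)
Lemma Cinv_mult (x y : C) : / (x * y) = / x * / y.
Proof.
destruct (Ceq_dec x 0) as [-> | Hx].
{ rewrite Cmult_0_l, Cinv_0. ring. }
destruct (Ceq_dec y 0) as [-> | Hy].
{ rewrite Cmult_0_r, Cinv_0. ring. }
field. auto.
Qed.

Lemma Cinv_inv (x : C) : / / x = x.
Proof.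
destruct (Ceq_dec x 0) as [-> | Hx].
- now rewrite !Cinv_0.
- field. exact Hx.
Qed.

Lemma Cdiv_mult_mult (a b c d : C) : (a * b) / (c * d) = (a / c) * (b / d).
Proof. unfold Cdiv. rewrite Cinv_mult. ring. Qed.

Lemma Cprod_app (l m : list C) : Cprod (l ++ m) = Cprod l * Cprod m.
Proof.
induction l as [|x l IH]; simpl; [ring|]. rewrite IH. ring.
Qed.

Lemma Cprod_map_mult {A : Type} (f g : A -> C) (l : list A) :
  Cprod (map (fun x => f x * g x) l) = Cprod (map f l) * Cprod (map g l).
Proof.
induction l as [|x l IH]; simpl; [ring|]. rewrite IH. ring.
Qed.

Lemma Cprod_map_div {A : Type} (f g : A -> C) (l : list A) :
  Cprod (map (fun x => f x / g x) l) = Cprod (map f l) / Cprod (map g l).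
Proof.
induction l as [|x l IH]; simpl.
- field.
- rewrite IH. symmetry. apply Cdiv_mult_mult.
Qed.

Lemma Cprod_map_const {A : Type} (c : C) (l : list A) :
  Cprod (map (fun _ => c) l) = c ^ length l.
Proof.
induction l as [|x l IH]; simpl; [reflexivity|]. now rewrite IH.
Qed.

Lemma Cprod_neq_0 (l : list C) : (forall x, In x l -> x <> 0) -> Cprod l <> 0.
Proof.
induction l as [|x l IH]; simpl; intros H.
- apply C1_nz.
- apply Cmult_neq_0; auto.
Qed.

(** * Recurrences for shifted factorials and integer powers *)

Lemma qpoch_nat (x q : C) (k : nat) :
  qpoch x q (Z.of_nat k) = Cprod (map (fun i => 1 - x * q ^ i) (seq 0 k)).
Proof.
rewrite <- (Nat2Z.id k) at 2. now destruct k.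
Qed.

Lemma qpoch_S (x q : C) (k : nat) :
  qpoch x q (Z.of_nat (S k)) = qpoch x q (Z.of_nat k) * (1 - x * q ^ k).
Proof.
rewrite !qpoch_nat, seq_S, map_app, Cprod_app. simpl. ring.
Qed.

Lemma qpoch_neg (x q : C) (k : nat) :
  qpoch x q (- Z.of_nat k) = Cprod (map (fun i => / (1 - x / q ^ i)) (seq 1 k)).
Proof.
destruct k as [|k]; [reflexivity|].
unfold qpoch. simpl Z.of_nat. simpl Z.opp. cbv iota beta.
now rewrite SuccNat2Pos.id_succ.
Qed.

Lemma qpoch_neg_S (x q : C) (k : nat) :
  qpoch x q (- Z.of_nat (S k)) = qpoch x q (- Z.of_nat k) / (1 - x / q ^ S k).
Proof.
rewrite !qpoch_neg, seq_S, map_app, Cprod_app. simpl. unfold Cdiv. ring.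
Qed.

Lemma qpochs_0 (xs : list C) (q : C) : qpochs xs q 0 = 1.
Proof.
unfold qpochs. simpl. rewrite Cprod_map_const. apply Cpow_1_l.
Qed.

Lemma qpochs_S (xs : list C) (q : C) (k : nat) :
  qpochs xs q (Z.of_nat (S k)) =
  qpochs xs q (Z.of_nat k) * Cprod (map (fun x => 1 - x * q ^ k) xs).
Proof.
unfold qpochs. rewrite <- Cprod_map_mult. f_equal. apply map_ext.
intros x. apply qpoch_S.
Qed.

Lemma qpochs_neg_S (xs : list C) (q : C) (k : nat) :
  qpochs xs q (- Z.of_nat (S k)) =
  qpochs xs q (- Z.of_nat k) / Cprod (map (fun x => 1 - x / q ^ S k) xs).
Proof.
unfold qpochs. rewrite <- Cprod_map_div. f_equal. apply map_ext.
intros x. apply qpoch_neg_S.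
Qed.

Lemma Czpow_nat (z : C) (k : nat) : Czpow z (Z.of_nat k) = z ^ k.
Proof.
rewrite <- (Nat2Z.id k) at 2. now destruct k.
Qed.

Lemma Czpow_neg (z : C) (k : nat) : Czpow z (- Z.of_nat k) = / z ^ k.
Proof.
destruct k as [|k].
- simpl. field.
- unfold Czpow. simpl Z.of_nat. simpl Z.opp. cbv iota beta.
  now rewrite SuccNat2Pos.id_succ.
Qed.

(** * Ratios of consecutive terms and the reflection of the bilateral series *)

Definition poised_ratio (bs : list C) (q a x : C) : C :=
  Cprod (map (fun b => (1 - b * x) / (1 - a * q / b * x)) bs).

(** In both ratios [x] stands for [q ^ k], so that letting [k] grow becomes [x -> 0]. This one
    collects the factors of the term ratio that do not involve the [b]. *)
Definition very_well_ratio (q a x : C) : C :=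
  (1 - a * x) * (1 - a * (q * x) ^ 2) / ((1 - q * x) * (1 - a * x ^ 2)).

Lemma W_term_0 (a : C) (bs : list C) (q z : C) : W_term a bs q z 0 = 1.
Proof.
unfold W_term. rewrite !qpochs_0. simpl. field.
Qed.

(* The square roots of [a] only enter through [(1 - s y) (1 + s y) = 1 - a y^2].
   Since [/ 0 = 0], no denominator has to be assumed nonzero here. *)
Lemma W_term_S (a : C) (bs : list C) (q z : C) (k : nat) :
  W_term a bs q z (S k) =
  W_term a bs q z k *
  (very_well_ratio q a (q ^ k) * poised_ratio bs q a (q ^ k) * z).
Proof.
unfold W_term. rewrite !qpochs_S, !map_app, !Cprod_app, map_map.
unfold poised_ratio. rewrite Cprod_map_div.
simpl (Cprod (map _ (_ :: _))).
set (s := Csqrt a). assert (Hs : a = s * s) by (symmetry; apply Csqrt_sqr).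
replace ((1 - a * q ^ k) * ((1 - q * s * q ^ k) * ((1 - - (q * s) * q ^ k) * 1)))
  with ((1 - a * q ^ k) * (1 - a * (q * q ^ k) ^ 2)) by (rewrite Hs; ring).
replace ((1 - q * q ^ k) * ((1 - s * q ^ k) * ((1 - - s * q ^ k) * 1)))
  with ((1 - q * q ^ k) * (1 - a * (q ^ k) ^ 2)) by (rewrite Hs; ring).
rewrite !Cdiv_mult_mult. unfold very_well_ratio. rewrite Cdiv_mult_mult.
rewrite (Cpow_S z k). ring.
Qed.

Lemma psi_term_0 (num den : list C) (q z : C) : psi_term num den q z 0 = 1.
Proof. unfold psi_term. rewrite !qpochs_0. simpl. field. Qed.

Lemma psi_term_S (bs : list C) (q z : C) (k : nat) :
  let p := psi_term bs (map (fun b => q / b) bs) q z in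
  p (Z.of_nat (S k)) = p (Z.of_nat k) * (poised_ratio bs q 1 (q ^ k) * z).
Proof.
intros p. unfold p, psi_term, poised_ratio.
rewrite !qpochs_S, !Czpow_nat, Cpow_S, map_map, Cdiv_mult_mult, Cprod_map_div.
rewrite (map_ext (fun b => 1 - 1 * q / b * q ^ k) (fun b => 1 - q / b * q ^ k))
  by (intros b; now rewrite Cmult_1_l).
ring.
Qed.

(** Going down, each [b] contributes [(1 - q / b / q ^ S k) / (1 - b / q ^ S k)]. Clearing the
    negative powers of [q] turns this into [q / b ^ 2] times the upward factor
    [(1 - b * q ^ k) / (1 - q / b * q ^ k)]. *)
Lemma psi_term_neg_S (bs : list C) (q z : C) (k : nat) :
  q <> 0 ->
  (forall b, In b bs -> b <> 0 /\ 1 - q / b * q ^ k <> 0) ->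
  let p := psi_term bs (map (fun b => q / b) bs) q z in
  p (- Z.of_nat (S k))%Z =
  p (- Z.of_nat k)%Z *
  (poised_ratio bs q 1 (q ^ k) * (q ^ length bs / Cprod bs ^ 2) / z).
Proof.
intros Hq Hbs p.
assert (Hr : poised_ratio bs q 1 (q ^ k) * (q ^ length bs / Cprod bs ^ 2) =
  Cprod (map (fun b => 1 - q / b / q ^ S k) bs) /
  Cprod (map (fun b => 1 - b / q ^ S k) bs)).
{ replace (q ^ length bs / Cprod bs ^ 2)
    with (Cprod (map (fun b => q / b * / b) bs)).
  - unfold poised_ratio. rewrite <- Cprod_map_mult, <- Cprod_map_div.
    f_equal. apply map_ext_in. intros b Hb. destruct (Hbs b Hb) as [Hb0 Hb1].
    rewrite Cpow_S.
    assert (Hk := Cpow_nz q k Hq). set (x := q ^ k) in *.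
    (* The downward denominator vanishes only for [b = q ^ S k], where [1 - q / b * q ^ k] would
       vanish too. *)
    assert (H1 : b - q * x <> 0).
    { intros H. apply Hb1. replace (1 - q / b * x) with ((b - q * x) / b)
        by (field; auto). rewrite H. unfold Cdiv. ring. }
    assert (H2 : q * x - b <> 0).
    { intros H. apply H1. replace (b - q * x) with (- (q * x - b)) by ring.
      rewrite H. ring. }
    field. repeat split; auto.
  - rewrite (map_ext _ (fun b => q / (b * b)))
      by (intros b; unfold Cdiv; rewrite Cinv_mult; ring).
    rewrite Cprod_map_div, Cprod_map_const, Cprod_map_mult, map_id.
    f_equal. ring. }
unfold p, psi_term.
rewrite !qpochs_neg_S, !Czpow_neg, map_map, Hr.
unfold Cdiv. rewrite (Cpow_S z k), !Cinv_mult, Cinv_inv. ring.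
Qed.

(** With [2 * r + 1] parameters and [z = q ^ r / Cprod bs], one has [q ^ (2 * r + 1) / Cprod bs ^ 2
    / z = q * z]: each downward ratio is [q] times the upward ratio at the same [k]. *)
Lemma psi_term_reflect (bs : list C) (q : C) (r k : nat) :
  q <> 0 -> length bs = (2 * r + 1)%nat ->
  (forall b, In b bs -> b <> 0 /\ forall n : nat, 1 - q / b * q ^ n <> 0) ->
  let p := psi_term bs (map (fun b => q / b) bs) q (q ^ r / Cprod bs) in
  p (- Z.of_nat k)%Z = q ^ k * p (Z.of_nat k).
Proof.
intros Hq Hlen Hbs p.
assert (HB : Cprod bs <> 0) by (apply Cprod_neq_0; intros b Hb; now apply Hbs).
induction k as [|k IH].
- simpl. ring.
- unfold p. rewrite psi_term_S, psi_term_neg_S; fold p.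
  + rewrite IH, Hlen, Cpow_add_r, Nat.mul_comm, Cpow_mult_r, Cpow_1_r, (Cpow_S q k).
    assert (Hr := Cpow_nz q r Hq). field. auto.
  + exact Hq.
  + intros b Hb. split; now apply Hbs.
Qed.

(** * Limits of the ratios and of the single terms *)

Lemma pow_to_0 (q : C) :
  (Cmod q < 1)%R -> filterlim (fun k => q ^ k) eventually (locally (RtoC 0)).
Proof.
intros Hq. apply Cfilterlim_iff; [apply eventually_filter|]. intros eps He.
destruct (pow_lt_1_zero (Cmod q)
  ltac:(rewrite Rabs_pos_eq; [exact Hq | apply Cmod_ge_0]) eps He) as [N HN].
exists N. intros n Hn. specialize (HN n Hn).
replace (q ^ n - 0) with (q ^ n) by ring. rewrite Cmod_pow.
rewrite Rabs_pos_eq in HN; [exact HN | apply pow_le, Cmod_ge_0].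
Qed.

Lemma pow_neq_1 (q : C) (k : nat) : (Cmod q < 1)%R -> (0 < k)%nat -> 1 - q ^ k <> 0.
Proof.
intros Hq Hk H.
assert (H1 : Cmod (q ^ k) = 1%R).
{ replace (q ^ k) with (1 - (1 - q ^ k)) by ring. rewrite H.
  replace (1 - 0) with (RtoC 1) by ring. apply Cmod_1. }
rewrite Cmod_pow in H1.
assert (H2 := pow_lt_1_compat (Cmod q) k (conj (Cmod_ge_0 q) Hq) Hk). lra.
Qed.

(** Needed for [tannery_ratio]; the point [x + eps / 2] shows that a punctured ball is not empty. *)
Global Instance locally'_C_proper (x : C) : ProperFilter (locally' x).
Proof.
split; [|apply locally'_filter].
intros P [eps HP]. exists (x + RtoC (eps / 2)).
assert (He := cond_pos eps).
apply HP.
- apply (C_NormedModule_mixin_compat1 x).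
  change (Cmod (x + RtoC (eps / 2) - x) < eps)%R.
  replace (x + RtoC (eps / 2) - x) with (RtoC (eps / 2)) by ring.
  rewrite Cmod_R, Rabs_pos_eq; lra.
- intros H. assert (H' : RtoC (eps / 2) = 0).
  { replace (RtoC (eps / 2)) with (x + RtoC (eps / 2) - x) by ring.
    rewrite H. ring. }
  apply RtoC_inj in H'. lra.
Qed.

Section RatioLimits.

Context {T : Type} {F : (T -> Prop) -> Prop} {FF : Filter F}.

Lemma Cfilterlim_const (c : C) : filterlim (fun _ : T => c) F (locally c).
Proof. exact (filterlim_const (U := C_UniformSpace) c). Qed.

Lemma Cfilterlim_minus (f g : T -> C) (l m : C) :
  filterlim f F (locally l) -> filterlim g F (locally m) ->
  filterlim (fun x => f x - g x) F (locally (l - m)).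
Proof.
intros Hf Hg. exact (Cfilterlim_plus _ _ _ _ Hf (Cfilterlim_opp _ _ Hg)).
Qed.

Lemma Cfilterlim_div (f g : T -> C) (l m : C) :
  m <> 0 -> filterlim f F (locally l) -> filterlim g F (locally m) ->
  filterlim (fun x => f x / g x) F (locally (l / m)).
Proof.
intros Hm Hf Hg. exact (Cfilterlim_mult _ _ _ _ Hf (Cfilterlim_inv _ _ Hm Hg)).
Qed.

Lemma Cfilterlim_pow (f : T -> C) (l : C) (n : nat) :
  filterlim f F (locally l) -> filterlim (fun x => f x ^ n) F (locally (l ^ n)).
Proof.
intros Hf. induction n as [|n IH]; [exact (Cfilterlim_const 1)|].
exact (Cfilterlim_mult _ _ _ _ Hf IH).
Qed.

Lemma Cfilterlim_Cprod (bs : list C) (f : C -> T -> C) (l : C -> C) :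
  (forall b, In b bs -> filterlim (f b) F (locally (l b))) ->
  filterlim (fun x => Cprod (map (fun b => f b x) bs)) F
    (locally (Cprod (map l bs))).
Proof.
induction bs as [|b bs IH]; simpl; intros H; [apply Cfilterlim_const|].
apply Cfilterlim_mult; auto.
Qed.

(** Letting [x] vary along with [a] covers both a fixed [k], where [x] is constantly [q ^ k], and
    the joint limit, where [x] tends to 0. *)
Lemma poised_ratio_lim (bs : list C) (q x0 : C) (a x : T -> C) :
  (forall b, In b bs -> 1 - q / b * x0 <> 0) ->
  filterlim a F (locally (RtoC 1)) -> filterlim x F (locally x0) ->
  filterlim (fun t => poised_ratio bs q (a t) (x t)) F
    (locally (poised_ratio bs q 1 x0)).
Proof.
intros Hbs Ha Hx. unfold poised_ratio.
apply Cfilterlim_Cprod with (f := fun b t => (1 - b * x t) / (1 - a t * q / b * x t)).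
intros b Hb. apply Cfilterlim_div.
- rewrite Cmult_1_l. now apply Hbs.
- apply Cfilterlim_minus; [apply Cfilterlim_const|].
  apply Cfilterlim_mult; [apply Cfilterlim_const | exact Hx].
- apply Cfilterlim_minus; [apply Cfilterlim_const|].
  apply Cfilterlim_mult; [|exact Hx].
  apply Cfilterlim_mult; [|apply Cfilterlim_const].
  apply Cfilterlim_mult; [exact Ha | apply Cfilterlim_const].
Qed.

Lemma very_well_ratio_lim (q x0 : C) (a x : T -> C) :
  1 - q * x0 <> 0 -> 1 - x0 ^ 2 <> 0 ->
  filterlim a F (locally (RtoC 1)) -> filterlim x F (locally x0) ->
  filterlim (fun t => very_well_ratio q (a t) (x t)) F
    (locally (very_well_ratio q 1 x0)).
Proof.
intros H1 H2 Ha Hx. unfold very_well_ratio.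
apply Cfilterlim_div.
- apply Cmult_neq_0; [exact H1 | now rewrite Cmult_1_l].
- apply Cfilterlim_mult; (apply Cfilterlim_minus; [apply Cfilterlim_const|]).
  + now apply Cfilterlim_mult.
  + apply Cfilterlim_mult; [exact Ha|]. apply Cfilterlim_pow.
    apply Cfilterlim_mult; [apply Cfilterlim_const | exact Hx].
- apply Cfilterlim_mult; (apply Cfilterlim_minus; [apply Cfilterlim_const|]).
  + apply Cfilterlim_mult; [apply Cfilterlim_const | exact Hx].
  + apply Cfilterlim_mult; [exact Ha | now apply Cfilterlim_pow].
Qed.

End RatioLimits.

Lemma poised_ratio_at_0 (bs : list C) (q a : C) : poised_ratio bs q a 0 = 1.
Proof.
unfold poised_ratio. rewrite (map_ext _ (fun _ => RtoC 1)).
- rewrite Cprod_map_const. apply Cpow_1_l.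
- intros b. replace (1 - a * q / b * 0) with (RtoC 1) by ring. field.
Qed.

(** At [a = 1] the ratio cancels to [(1 + q * x) / (1 + x)], so its product over [x = q, q ^ 2, ...]
    telescopes; this produces the factor [1 + q ^ k]. *)
Lemma very_well_ratio_at_1 (q x : C) :
  1 - q * x <> 0 -> 1 - x ^ 2 <> 0 ->
  (1 + x) * very_well_ratio q 1 x = 1 + q * x.
Proof.
intros H1 H2. unfold very_well_ratio. field. split; [|exact H1].
intros H. apply H2. rewrite <- H. ring.
Qed.

Lemma argument_lim {T : Type} (F : (T -> Prop) -> Prop) {FF : Filter F}
    (a : T -> C) (c d : C) (r : nat) :
  filterlim a F (locally (RtoC 1)) ->
  filterlim (fun t => a t ^ r * c / d) F (locally (c / d)).
Proof.
intros Ha. replace (c / d) with (1 ^ r * c * / d)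
  by (rewrite Cpow_1_l; unfold Cdiv; ring).
apply (Cfilterlim_mult _ (fun _ => / d)); [|apply Cfilterlim_const].
apply Cfilterlim_mult; [|apply Cfilterlim_const].
now apply Cfilterlim_pow.
Qed.

Lemma locally'_id_lim (x : C) :
  filterlim (fun a : C => a) (locally' x) (locally x).
Proof. exact (filter_le_within _). Qed.

(** Index 0 is separate because [1 + q ^ 0] is 2 whereas the zeroth term is 1 for every [a]. *)
Lemma W_term_lim (q c d : C) (r : nat) (bs : list C) (k : nat) :
  (Cmod q < 1)%R ->
  (forall b, In b bs -> forall n : nat, 1 - q / b * q ^ n <> 0) ->
  filterlim (fun a => W_term a bs q (a ^ r * c / d) k) (locally' (RtoC 1))
    (locally match k with
             | O => RtoC 1
             | S _ => (1 + q ^ k) *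
                 psi_term bs (map (fun b => q / b) bs) q (c / d) (Z.of_nat k)
             end).
Proof.
intros Hq Hbs.
induction k as [|k IH].
{ apply (filterlim_ext (fun _ => RtoC 1)); [intros; now rewrite W_term_0|].
  apply Cfilterlim_const. }
assert (HP : filterlim (fun a => poised_ratio bs q a (q ^ k)) (locally' (RtoC 1))
  (locally (poised_ratio bs q 1 (q ^ k)))).
{ apply (poised_ratio_lim bs q (q ^ k) (fun a => a) (fun _ => q ^ k)).
  - intros b Hb. now apply Hbs.
  - apply locally'_id_lim.
  - apply Cfilterlim_const. }
assert (HZ := argument_lim (locally' (RtoC 1)) (fun a => a) c d r
  (locally'_id_lim _)).
assert (Hqk := pow_neq_1 q (S k) Hq (Nat.lt_0_succ k)).
rewrite psi_term_S.
(* For [k = 0] a factor [1 - a] stands above and below. It cancels for [a <> 1], leaving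
   [(1 - a * q ^ 2) / (1 - q)], which tends to [1 + q]; at [a = 1] itself the ratio evaluates to 0,
   so the punctured neighbourhood matters. *)
assert (HV : filterlim (fun a => very_well_ratio q a (q ^ k)) (locally' (RtoC 1))
  (locally match k with
           | O => 1 + q
           | S _ => very_well_ratio q 1 (q ^ k)
           end)).
{ destruct k as [|k].
  - replace (1 + q) with ((1 - 1 * q ^ 2) / (1 - q)).
    2: { rewrite Cpow_1_r in Hqk. field. exact Hqk. }
    apply (filterlim_ext_loc (fun a => (1 - a * q ^ 2) / (1 - q))).
    + exists (mkposreal 1 Rlt_0_1). intros a _ Ha.
      unfold very_well_ratio. rewrite Cpow_1_r in Hqk. simpl. field.
      repeat split; try exact Hqk; intros H; apply Ha.
      * symmetry. now apply Cminus_diag_uniq.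
    + apply Cfilterlim_div.
      * rewrite Cpow_1_r in Hqk. exact Hqk.
      * apply Cfilterlim_minus; [apply Cfilterlim_const|].
        apply Cfilterlim_mult; [apply locally'_id_lim | apply Cfilterlim_const].
      * apply Cfilterlim_const.
  - apply (very_well_ratio_lim q (q ^ S k) (fun a => a) (fun _ => q ^ S k)).
    + exact Hqk.
    + rewrite <- Cpow_mult_r. apply pow_neq_1; [exact Hq | lia].
    + apply locally'_id_lim.
    + apply Cfilterlim_const. }
apply (filterlim_ext
  (fun a => W_term a bs q (a ^ r * c / d) k *
     (very_well_ratio q a (q ^ k) * poised_ratio bs q a (q ^ k) *
      (a ^ r * c / d)))); [intros; now rewrite W_term_S|].
assert (HL := Cfilterlim_mult _ _ _ _ IH
  (Cfilterlim_mult _ _ _ _ (Cfilterlim_mult _ _ _ _ HV HP) HZ)).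
refine (eq_ind (A := C) _ (fun l => filterlim _ _ (locally l)) HL _ _).
destruct k as [|k].
- simpl Z.of_nat. rewrite psi_term_0, Cpow_1_r. ring.
- rewrite (Cpow_S q (S k)), <- very_well_ratio_at_1.
  + ring.
  + exact Hqk.
  + rewrite <- Cpow_mult_r. apply pow_neq_1; [exact Hq | lia].
Qed.

(** * The limit as [a] tends to 1, and the two halves of the bilateral series *)

Theorem lemma5 :
  forall (q : C) (r : nat) (bs : list C),
    (0 < Cmod q < 1)%R ->
    length bs = (2 * r + 1)%nat ->
    (forall b : C, In b bs -> b <> 0 /\ forall n : nat, 1 - q / b * q ^ n <> 0) ->
    (Cmod (q ^ r / Cprod bs) < 1)%R ->
    let z := fun a : C => a ^ r * q ^ r / Cprod bs in
    let to1 := within (fun a : C =>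
                 (Rmax (Cmod (z a)) (Cmod (q ^ r / Cprod bs)) < 1)%R)
                 (locally' (RtoC 1)) in
    let den := map (fun b => q / b) bs in
    to1 (fun a => ex_series (W_term a bs q (z a))) /\
    ex_biseries (psi_term bs den q (q ^ r / Cprod bs)) /\
    filterlim (fun a => W a bs q (z a)) to1
      (locally (psi bs den q (q ^ r / Cprod bs))).
Proof.
intros q r bs Hq Hlen Hbs Hz z to1 den.
set (z0 := q ^ r / Cprod bs) in *.
assert (Hq0 : q <> 0) by (apply Cmod_gt_0; apply Hq).
(* [to1] refines the punctured neighbourhood filter, so limits along the latter carry over. *)
assert (Hle : filter_le to1 (locally' (RtoC 1))).
{ intros P HP. exact (filter_imp (F := locally' (RtoC 1)) _ _ (fun a Ha _ => Ha) HP). }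
assert (Hdisc : forall b, In b bs -> 1 - q / b * 0 <> 0).
{ intros b _. replace (1 - q / b * 0) with (RtoC 1) by ring. apply C1_nz. }
assert (Hpow : filterlim (fun x : C * nat => q ^ snd x)
  (filter_prod (locally' (RtoC 1)) eventually) (locally (RtoC 0))).
{ exact (filterlim_comp _ _ _ snd (fun k => q ^ k) _ _ _ filterlim_snd
           (pow_to_0 q (proj2 Hq))). }
assert (Hfst : filterlim fst (filter_prod (locally' (RtoC 1)) eventually)
  (locally (RtoC 1))).
{ exact (filterlim_comp _ _ _ fst (fun a => a) _ _ _ filterlim_fst
           (locally'_id_lim (RtoC 1))). }
set (p := psi_term bs den q z0) in *.
set (u := fun k : nat => match k with
                         | O => RtoC 1
                         | S _ => (1 + q ^ k) * p (Z.of_nat k)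
                         end).
destruct (tannery_ratio (locally' (RtoC 1)) u (fun a => W_term a bs q (z a))
  (fun a k => very_well_ratio q a (q ^ k) * poised_ratio bs q a (q ^ k) * z a) z0)
  as (HW & Hu & Hlim).
- exact Hz.
- intros a k. apply W_term_S.
(* Both ratios equal 1 at [x = 0]. *)
- replace z0 with (very_well_ratio q 1 0 * poised_ratio bs q 1 0 * z0).
  + apply Cfilterlim_mult; [apply Cfilterlim_mult|].
    * apply very_well_ratio_lim; auto.
      -- replace (1 - q * 0) with (RtoC 1) by ring. apply C1_nz.
      -- replace (1 - 0 ^ 2) with (RtoC 1) by ring. apply C1_nz.
    * now apply poised_ratio_lim.
    * exact (argument_lim _ fst (q ^ r) (Cprod bs) r Hfst).
  + rewrite poised_ratio_at_0. unfold very_well_ratio. field.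
- intros k. apply W_term_lim; [apply Hq|]. intros b Hb. now apply Hbs.
(* The nonnegative half converges by the same criterion, applied to a family constant in [a]. *)
- destruct (tannery_ratio (locally' (RtoC 1)) (fun k => p (Z.of_nat k))
    (fun _ k => p (Z.of_nat k)) (fun _ k => poised_ratio bs q 1 (q ^ k) * z0) z0)
    as (_ & Hp & _).
  + exact Hz.
  + intros _ k. apply psi_term_S.
  + assert (HL := Cfilterlim_mult _ (fun _ => z0) _ _
      (poised_ratio_lim bs q 0 _ _ Hdisc (Cfilterlim_const 1) Hpow)
      (Cfilterlim_const z0)).
    rewrite poised_ratio_at_0, Cmult_1_l in HL. exact HL.
  + intros k. apply Cfilterlim_const.
  (* By reflection the term at [-k] is [q ^ k * p k = u k - p k] for [k > 0], so the negative half
     is a difference of two convergent series. *)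
  + assert (Hneg : forall n : nat,
      p (- Z.of_nat (S n))%Z = u (S n) - p (Z.of_nat (S n))).
    { intros n. unfold p, den. rewrite (psi_term_reflect bs q r); auto.
      unfold u, p, den, z0. ring. }
    assert (Hu' := proj1 (ex_series_incr_1 (V := C_NormedModule) u) Hu).
    assert (Hp' := proj1 (ex_series_incr_1 (V := C_NormedModule) _) Hp).
    assert (Hsum : is_series (fun n => p (- Z.of_nat (S n))%Z)
      (CSeries (fun n => u (S n)) - CSeries (fun n => p (Z.of_nat (S n))))).
    { apply (is_series_ext (V := C_NormedModule)
        (fun n => u (S n) - p (Z.of_nat (S n)))).
      - intros n. symmetry. apply Hneg.
      - exact (is_series_minus (V := C_NormedModule) _ _ _ _
                 (CSeries_correct _ Hu') (CSeries_correct _ Hp')). }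
    split; [|split].
    * apply Hle. exact HW.
    * split; [exact Hp | eexists; exact Hsum].
    * apply (filterlim_filter_le_1 _ Hle).
      replace (psi bs den q z0) with (CSeries u); [exact Hlim|].
      unfold psi, CBiseries. fold p.
      rewrite (CSeries_unique _ _ Hsum), (CSeries_incr_1 u Hu),
        (CSeries_incr_1 (fun k => p (Z.of_nat k)) Hp).
      change (p (Z.of_nat 0)) with (psi_term bs den q z0 0).
      rewrite psi_term_0. unfold u at 1. ring.
Qed.
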